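(* Let $R$ be a commutative ring, $A=\mathrm{S}_4(R)$ and $M=\mathrm{M}_3(R)$. Then $H^n(A,M/A)$ is a free $R$-module for all $n\ge0$, with $\mathrm{rank}_RH^0(A,M/A)=4$ and $\mathrm{rank}_RH^n(A,M/A)=3\cdot2^n$ for $n\ge1$.
   Context: $\mathrm{S}_4(R)=\left\{\begin{pmatrix}a&b&c\\0&a&0\\0&0&a\end{pmatrix}\mid a,b,c\in R\right\}\subseteq\mathrm{M}_3(R)$. $H^n$ is Hochschild cohomology, with $M/A$ an $A$-bimodule via matrix multiplication. *)

(* Defs.v *)
(* Hochschild cohomology H^n(A, M/A) for A = S_4(R) in M = M_3(R),
   computed by the standard Hochschild cochain complex C^n(A,N) = Hom_R(A^{(x)n}, N),
   with R-multilinear cochains. *)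
From mathcomp Require Import all_boot all_order all_algebra.
Set Implicit Arguments. Unset Strict Implicit. Unset Printing Implicit Defensive.
Import GRing.Theory.
Local Open Scope ring_scope.

Section Defs.
Variable R : comNzRingType.
Local Notation M := 'M[R]_3.

Definition s4mx (a b c : R) : M :=
  \matrix_(i < 3, j < 3)
    if i == j then a
    else if (i == 0 :> nat) && (j == 1 :> nat) then b
    else if (i == 0 :> nat) && (j == 2 :> nat) then c
    else 0.

Definition inS4 (X : M) : Prop := exists a b c : R, X = s4mx a b c.

Definition cochain_arg (n : nat) (s : seq M) : Prop :=
  size s = n /\ forall i, (i < size s)%N -> inS4 (nth 0 s i).

(* An n-cochain with values in M/A is represented by an R-multilinear map
   A^n -> M (lifting through M -> M/A is possible since A^{(x)n} is free);
   only its values on A^n matter. *)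
Definition is_cochain (n : nat) (f : seq M -> M) : Prop :=
  forall s, cochain_arg n s -> forall i, (i < n)%N ->
  forall (r : R) (y : M), inS4 y ->
    f (set_nth 0 s i (r *: nth 0 s i + y)) = r *: f s + f (set_nth 0 s i y).

Definition merge (i : nat) (s : seq M) : seq M :=
  take i s ++ (nth 0 s i *m nth 0 s i.+1) :: drop i.+2 s.

Definition hdiff (n : nat) (f : seq M -> M) : seq M -> M := fun s =>
  nth 0 s 0 *m f (behead s)
  + \sum_(i < n) ((-1) ^+ i.+1) *: f (merge i s)
  + ((-1) ^+ n.+1) *: (f (take n s) *m nth 0 s n).

Definition congrA (n : nat) (f g : seq M -> M) : Prop :=
  forall s, cochain_arg n s -> inS4 (f s - g s).

Definition is_cocycle (n : nat) (f : seq M -> M) : Prop :=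
  is_cochain n f /\ congrA n.+1 (hdiff n f) (fun _ => 0).

Definition cohomologous (n : nat) (f g : seq M -> M) : Prop :=
  match n with
  | 0 => congrA 0 f g
  | m.+1 => exists h, is_cochain m h /\ congrA m.+1 f (fun s => g s + hdiff m h s)
  end.

Definition lincomb (k : nat) (r : 'I_k -> R) (z : 'I_k -> seq M -> M) : seq M -> M :=
  fun s => \sum_(i < k) r i *: z i s.

Definition HH_free_of_rank (n k : nat) : Prop :=
  exists z : 'I_k -> seq M -> M,
    (forall i, is_cocycle n (z i)) /\
    (forall f, is_cocycle n f -> exists r : 'I_k -> R, cohomologous n f (lincomb r z)) /\
    (forall r : 'I_k -> R, cohomologous n (lincomb r z) (fun _ => 0) -> forall i, r i = 0).

End Defs.

(* Main.v *)
(* A = S_4(R) is R + J with J = R E_12 + R E_13 and J^2 = 0. Every cocycle is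
   cohomologous to a normalized one, vanishing as soon as an argument is 1, and a
   normalized cochain is a function on words in the two basis letters of J, with
     (dh)(j_0 ... j_n) = j_0 h(j_1 ... j_n) + (-1)^(n+1) h(j_0 ... j_(n-1)) j_n.
   J annihilates on both sides the rank 4 submodule N_0 of M/A given by the
   vanishing of the entries (2,1) and (3,1), and the quotient of M/A by N_0, of
   rank 2. So d maps the E_21 and E_31 components of a cochain to cochains with
   values in N_0, and it does so split injectively: right multiplication by E_13
   carries the entry (2,1) to (2,3), right multiplication by E_12 carries the entry
   (3,1) to (3,2), and nothing else reaches these entries. Hence H^n is free of rank
   4 2^n - 2 2^(n-1) = 3 2^n for n >= 1, and of rank 4 for n = 0. *)
Require Import Defs.
From mathcomp Require Import all_boot all_order all_algebra.
Set Implicit Arguments. Unset Strict Implicit. Unset Printing Implicit Defensive.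
Import GRing.Theory.
Local Open Scope ring_scope.

(* The basis of S_4(R): [None] is the unit, [Some false] and [Some true] are the
   matrix units E_12 and E_13, which span the ideal J; [lmul] is [None] when the
   product vanishes. *)
Notation letter := (option bool).

Definition lmul (a b : letter) : option letter :=
  match a, b with
  | None, _ => Some b
  | _, None => Some a
  | _, _ => None
  end.

(** The actions are those of the basis letters on an additive group, so that the induction on the
    degree can pass from [V] to [V * V] within the same notion. *)
Record bimodule (V : zmodType) (l r : letter -> V -> V) : Prop := Bimodule {
  actlB : forall a, {morph l a : u v / u - v};
  actrB : forall a, {morph r a : u v / u - v};
  actl1 : forall v, l None v = v;
  actr1 : forall v, r None v = v;
  actlM : forall a b v, l a (l b v) = oapp (fun c => l c v) 0 (lmul a b);
  actrM : forall a b v, r b (r a v) = oapp (fun c => r c v) 0 (lmul a b);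
  actlr : forall a b v, l a (r b v) = r b (l a v) }.

(** * The Hochschild complex on words of basis letters *)

Section BarComplex.
Variables (V : zmodType) (l r : letter -> V -> V).

(* [bar_diff] is the Hochschild differential read on words of basis letters. In
   [bar_tail], which omits the term with the left action, the merge at the front
   (or the right action on a one-letter word) is [premul], and the other terms are
   those of the cochain [F (a :: _)] with opposite signs. *)
Definition premul (a : letter) (F : seq letter -> V) (u : seq letter) : V :=
  if u is b :: u' then oapp (fun c => F (c :: u')) 0 (lmul a b) else r a (F [::]).

Fixpoint bar_tail (F : seq letter -> V) (w : seq letter) : V :=
  if w is a :: u then - premul a F u - bar_tail (fun v => F (a :: v)) u else 0.

Definition bar_diff (F : seq letter -> V) (w : seq letter) : V :=
  if w is a :: u then l a (F u) + bar_tail F w else 0.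

Lemma bar_tail_cons a F u :
  bar_tail F (a :: u) = - premul a F u - bar_tail (fun v => F (a :: v)) u.
Proof. by []. Qed.

Lemma bar_diff_cons a F u : bar_diff F (a :: u) = l a (F u) + bar_tail F (a :: u).
Proof. by []. Qed.

Lemma eq_premul a F G u : F =1 G -> premul a F u = premul a G u.
Proof. by case: u => [|b u] /= eqFG; [rewrite eqFG | case: lmul => //= c; rewrite eqFG]. Qed.

Lemma eq_bar_tail F G w : F =1 G -> bar_tail F w = bar_tail G w.
Proof.
elim: w F G => [|a w IHw] F G eqFG //=; rewrite (eq_premul _ _ eqFG).
by rewrite (IHw _ (fun u => G (a :: u))).
Qed.

Lemma eq_bar_diff F G w : F =1 G -> bar_diff F w = bar_diff G w.
Proof. by case: w => // a w eqFG; rewrite /bar_diff eqFG (eq_bar_tail _ eqFG). Qed.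

Hypothesis V_bimod : bimodule l r.

Let l0 a : l a 0 = 0.
Proof. by rewrite -{1}(subrr 0) (actlB V_bimod) subrr. Qed.

Let r0 a : r a 0 = 0.
Proof. by rewrite -{1}(subrr 0) (actrB V_bimod) subrr. Qed.

Let lN a v : l a (- v) = - l a v.
Proof. by rewrite -sub0r (actlB V_bimod) l0 sub0r. Qed.

Let lD a u v : l a (u + v) = l a u + l a v.
Proof. by rewrite -[v in LHS]opprK (actlB V_bimod) lN opprK. Qed.

Lemma bar_tail0 w : bar_tail (fun=> 0) w = 0.
Proof.
elim: w => [|a w IHw] //=; rewrite IHw subr0.
by case: w {IHw} => [|b w] /=; [rewrite r0 | case: lmul => [c|] /=]; rewrite oppr0.
Qed.

Lemma premulB a F G u : premul a (fun v => F v - G v) u = premul a F u - premul a G u.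
Proof.
case: u => [|b u] /=; first by rewrite (actrB V_bimod).
by case: lmul => [c|] //=; rewrite subr0.
Qed.

Lemma bar_tailB F G w :
  bar_tail (fun u => F u - G u) w = bar_tail F w - bar_tail G w.
Proof.
elim: w F G => [|a w IHw] F G /=; first by rewrite subr0.
by rewrite premulB IHw !opprD !opprK addrACA.
Qed.

Lemma bar_diffB F G w :
  bar_diff (fun u => F u - G u) w = bar_diff F w - bar_diff G w.
Proof.
case: w => [|a w]; first by rewrite subr0.
by rewrite !bar_diff_cons (actlB V_bimod) bar_tailB addrACA -opprD.
Qed.

Lemma bar_diffD F G w :
  bar_diff (fun u => F u + G u) w = bar_diff F w + bar_diff G w.
Proof.
have <- : bar_diff (fun u => (F u + G u) - G u) w = bar_diff F w.
  by apply: eq_bar_diff => u; rewrite addrK.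
by rewrite bar_diffB subrK.
Qed.

Lemma bar_tail_actl a F w : bar_tail (fun u => l a (F u)) w = l a (bar_tail F w).
Proof.
elim: w F => [|b w IHw] F /=; first by rewrite l0.
rewrite IHw (actlB V_bimod) lN; congr (- _ - _).
case: w {IHw} => [|c w] /=; first by rewrite (actlr V_bimod).
by case: lmul => //=; rewrite l0.
Qed.

(** Associativity of the product of letters, with [actrM] in its place where the word ends: [a] may
    be merged into the first letter before or after the tail is taken. *)
Lemma bar_tail_premul a F b w :
  bar_tail (premul a F) (b :: w) = oapp (fun c => bar_tail F (c :: w)) 0 (lmul a b).
Proof.
rewrite bar_tail_cons; case: a b => [a|] [b|] //=.
  rewrite bar_tail0 subr0; case: w => [|c w] /=.
    by rewrite (actrM V_bimod) /= oppr0.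
  by case: c => [c|] /=; rewrite oppr0.
all: by case: w => [|[c|] w] /=; rewrite ?(actrM V_bimod).
Qed.

(** The tail is the differential with the left action set to zero. By induction only the two double
    merges at the front are left, and they cancel by [bar_tail_premul]. *)
Lemma bar_tailK F w : bar_tail (bar_tail F) w = 0.
Proof.
elim: w F => [|a w IHw] F //; rewrite bar_tail_cons.
rewrite (@eq_bar_tail (fun v => bar_tail F (a :: v))
  (fun u => (0 - premul a F u) - bar_tail (fun v => F (a :: v)) u)); last first.
  by move=> u; rewrite bar_tail_cons sub0r.
rewrite !bar_tailB bar_tail0 IHw subr0 sub0r opprK.
by case: w {IHw} => [|b w]; [rewrite /= r0 oppr0 addr0 | rewrite bar_tail_premul addNr].
Qed.

Lemma bar_diffK F w : bar_diff (bar_diff F) w = 0.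
Proof.
case: w => [|a w] //; rewrite bar_diff_cons bar_tail_cons.
rewrite (@eq_bar_tail (fun v => bar_diff F (a :: v))
  (fun u => (l a (F u) - premul a F u) - bar_tail (fun v => F (a :: v)) u)); last first.
  by move=> u; rewrite bar_diff_cons bar_tail_cons addrA.
rewrite !bar_tailB bar_tailK subr0 bar_tail_actl.
case: w => [|b w]; first by rewrite /= l0 r0 subr0 oppr0 !addr0.
rewrite bar_tail_premul bar_diff_cons lD (actlM V_bimod).
have -> : premul a (bar_diff F) (b :: w) =
    oapp (fun c => l c (F w)) 0 (lmul a b) + oapp (fun c => bar_tail F (c :: w)) 0 (lmul a b).
  by rewrite /premul; case: lmul => [c|] //=; rewrite addr0.
move: (oapp _ _ _) (oapp _ _ _) (l a _) => x y z.
by rewrite opprB opprD [- _ - _ + (_ - _)]addrA subrK -opprD subrr.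
Qed.

End BarComplex.

(** * Dimension shift: the bimodule Hom(J, V) *)

Section Shift.
Variables (V : zmodType) (l r : letter -> V -> V).

(** A pair is the map f from J to [V] whose values at E_12 and E_13 are its two components. *)
Definition coef (j : bool) (p : V * V) : V := if j then p.2 else p.1.

(** The action (b f)(x) = f(x b) - x f(b), with f(1) = 0. For b in J the product x b vanishes and -
    x f(b) remains. *)
Definition shiftl (b : letter) (p : V * V) : V * V :=
  if b is Some j then (- l (Some false) (coef j p), - l (Some true) (coef j p)) else p.

Definition shiftr (b : letter) (p : V * V) : V * V := (r b p.1, r b p.2).

Lemma coef0 j : coef j 0 = 0. Proof. by case: j. Qed.
Lemma coefN j p : coef j (- p) = - coef j p. Proof. by case: j. Qed.
Lemma coefD j p q : coef j (p + q) = coef j p + coef j q. Proof. by case: j. Qed.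
Lemma coefB j p q : coef j (p - q) = coef j p - coef j q. Proof. by case: j. Qed.

Lemma coef_shiftl j k p : coef j (shiftl (Some k) p) = - l (Some j) (coef k p).
Proof. by case: j. Qed.

Lemma coef_shiftr j b p : coef j (shiftr b p) = r b (coef j p).
Proof. by case: j. Qed.

Lemma coef_eq p q : (forall j, coef j p = coef j q) -> p = q.
Proof.
by case: p q => [p1 p2] [q1 q2] pq; move: (pq false) (pq true) => /= -> ->.
Qed.

Lemma bimodule_shift : bimodule l r -> bimodule shiftl shiftr.
Proof.
move=> Vb.
have l0 a : l a 0 = 0 by rewrite -{1}(subrr 0) (actlB Vb) subrr.
have lN a v : l a (- v) = - l a v by rewrite -sub0r (actlB Vb) l0 sub0r.
have r0 a : r a 0 = 0 by rewrite -{1}(subrr 0) (actrB Vb) subrr.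
have rN a v : r a (- v) = - r a v by rewrite -sub0r (actrB Vb) r0 sub0r.
split.
- case=> [k|] // p q; apply: coef_eq => j.
  by rewrite coefB !coef_shiftl coefB (actlB Vb) opprD.
- by move=> a p q; apply: coef_eq => j; rewrite coefB !coef_shiftr coefB (actrB Vb).
- by [].
- by move=> p; apply: coef_eq => j; rewrite coef_shiftr (actr1 Vb).
- case=> [a|] [b|] p //; apply: coef_eq => j.
  by rewrite !coef_shiftl lN opprK (actlM Vb) coef0.
- move=> a b p; apply: coef_eq => j; rewrite !coef_shiftr (actrM Vb).
  by case: lmul => [c|] /=; rewrite ?coef_shiftr ?coef0.
- case=> [a|] b p //; apply: coef_eq => j.
  by rewrite coef_shiftr !coef_shiftl coef_shiftr (actlr Vb) rN.
Qed.

Lemma coef_bar_tail j F w :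
  coef j (bar_tail shiftr F w) = bar_tail r (fun u => coef j (F u)) w.
Proof.
elim: w F => [|a w IHw] F /=; first by rewrite coef0.
rewrite coefB coefN IHw; congr (- _ - _).
case: w {IHw} => [|b w] /=; first by rewrite coef_shiftr.
by case: lmul => //=; rewrite coef0.
Qed.

(** Fixing the first letter in J lowers the degree by one. The unit acts on Hom(J, V) as if f(1) =
    0, so for [b = None] the term x f(1) has to be taken off. *)
Lemma coef_bar_diff_shift j (G : seq letter -> V) G' b w :
  bimodule l r -> (forall i u, coef i (G' u) = - G (Some i :: u)) ->
  coef j (bar_diff shiftl shiftr G' (b :: w)) =
    bar_diff l r G (Some j :: b :: w) - (if b is None then l (Some j) (G (None :: w)) else 0).
Proof.
move=> Vb GG'; have lN a v : l a (- v) = - l a v.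
  have l0 : l a 0 = 0 by rewrite -{1}(subrr 0) (actlB Vb) subrr.
  by rewrite -sub0r (actlB Vb) l0 sub0r.
rewrite !bar_diff_cons (bar_tail_cons r (Some j)) coefD coef_bar_tail.
have -> : bar_tail r (fun u => coef j (G' u)) (b :: w) =
    - bar_tail r (fun u => G (Some j :: u)) (b :: w).
  rewrite (@eq_bar_tail _ _ _ (fun u => 0 - G (Some j :: u))).
    by rewrite (bar_tailB Vb) (bar_tail0 Vb) sub0r.
  by move=> u; rewrite GG' sub0r.
case: b => [k|]; last by rewrite GG' [RHS]addrC addKr.
by rewrite coef_shiftl GG' lN opprK subr0 [premul _ _ _ _]/= oppr0 sub0r.
Qed.

End Shift.

(* Induction on the degree: inserting a unit in front kills [F] on the words
   that begin with [None], and what is left is a cocycle of one degree less with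
   values in the bimodule Hom(J, V) = V * V of [shiftl] and [shiftr]. *)
Lemma cocycle_normalize n (V : zmodType) (l r : letter -> V -> V) (Z : V -> Prop) F :
  bimodule l r ->
  Z 0 -> (forall u v, Z u -> Z v -> Z (u - v)) -> (forall a v, Z v -> Z (l a v)) ->
  (forall w, size w = n.+1 -> Z (bar_diff l r F w)) ->
  exists h, forall w, size w = n -> None \in w -> Z (F w - bar_diff l r h w).
Proof.
elim: n V l r Z F => [|n IHn] V l r Z F Vb Z0 ZB Zl ZF.
  by exists (fun=> 0); case.
have ZN v : Z v -> Z (- v) by move=> Zv; rewrite -sub0r; apply: ZB.
pose s u := F (None :: u).
pose F1 u := F u - bar_diff l r s u.
have dF1 w : bar_diff l r F1 w = bar_diff l r F w.
  by rewrite /F1 (bar_diffB Vb) (bar_diffK Vb) subr0.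
have ZF1 w : size w = n -> Z (F1 (None :: w)).
  (* In the cocycle condition at the word 1, 1, w the left action and the first merge cancel, and
     the rest is [F1 (None :: w)]. *)
  move=> sz_w; have := ZF [:: None, None & w]; rewrite [size _]/= sz_w => /(_ erefl).
  rewrite /F1 !bar_diff_cons !(actl1 Vb) (bar_tail_cons r None F).
  rewrite addrA [_ - premul _ _ _ _]subrr add0r => Zt.
  by rewrite [- (s _ + _)]opprD addrA [_ - s _]subrr add0r.
(* The new [Z] consists of the maps from J with values in the old one; the signs are those required
   by [coef_bar_diff_shift]. *)
have [||||h' hP] := IHn _ (shiftl l) (shiftr r) (fun p => forall j, Z (coef j p))
  (fun w => (- F1 (Some false :: w), - F1 (Some true :: w))) (bimodule_shift Vb).
- by move=> j; rewrite coef0.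
- by move=> p q Zp Zq j; rewrite coefB; apply: ZB.
- move=> [a|] p Zp j //; rewrite coef_shiftl; exact/ZN/Zl.
- move=> [//|b w] [sz_w] j; rewrite (@coef_bar_diff_shift _ l r j F1) //; last by case.
  rewrite dF1; apply: ZB; first by apply: ZF; rewrite /= sz_w.
  by case: b => [k|] //; apply/Zl/ZF1.
(* Undoes the shift. The value 0 at words that begin with the unit makes the correction term of
   [coef_bar_diff_shift] vanish. *)
pose h u := if u is Some j :: w then - coef j (h' w) else 0.
exists (fun u => s u - h u) => w sz_w w1; rewrite (bar_diffB Vb) opprB addrCA -/(F1 w).
case: w sz_w w1 => // [[j|] w] [sz_w].
  rewrite inE /= => w1; have /ZN := hP w sz_w w1 j.
  case: w sz_w w1 => // b w _ _; rewrite coefB (@coef_bar_diff_shift _ l r j h) //.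
    have -> : (if b is None then l (Some j) (h (None :: w)) else 0) = 0.
      by case: b => //=; rewrite -{1}(subrr 0) (actlB Vb) subrr.
    have -> : coef j (- F1 (Some false :: b :: w), - F1 (Some true :: b :: w)) =
        - F1 (Some j :: b :: w) by case: j.
    by rewrite subr0 opprB opprK.
  by move=> i u; rewrite /h opprK.
move=> _; suff -> : bar_diff l r h (None :: w) = 0 by rewrite add0r; apply: ZF1.
rewrite bar_diff_cons bar_tail_cons (actl1 Vb) [bar_tail _ _ _](bar_tail0 Vb) subr0.
by case: w {sz_w} => [|a w] /=; rewrite ?(actr1 Vb) subrr.
Qed.

(** * Normalized cochains *)

Section Normalized.
Variables (V : zmodType) (l r : letter -> V -> V).
Hypothesis V_bimod : bimodule l r.

Definition normalized (G : seq letter -> V) := forall w, None \in w -> G w = 0.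

Lemma bar_tail_unit G w : normalized G -> bar_tail r G (None :: w) = - G w.
Proof.
move=> Gn; rewrite bar_tail_cons (@eq_bar_tail _ _ _ (fun=> 0)) => [|u].
  rewrite (bar_tail0 V_bimod) subr0; case: w => [|b w] //=.
  by rewrite (actr1 V_bimod).
by rewrite Gn ?mem_head.
Qed.

(** A unit inside the word counts only through its merges with the two neighbours (or the right
    action, at the end), and these have opposite signs. *)
Lemma bar_tail_normalized G j w :
  normalized G -> None \in w -> bar_tail r G (Some j :: w) = 0.
Proof.
elim: w j G => // [[k|] w] IHw j G Gn; rewrite bar_tail_cons; last first.
  move=> _; rewrite bar_tail_unit ?opprK ?addNr // => u u1.
  by apply: Gn; rewrite inE u1 orbT.
rewrite in_cons => /orP[//|w1].
rewrite (_ : premul _ _ _ _ = 0) // IHw ?oppr0 ?addr0 // => u u1.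
by apply: Gn; rewrite inE u1 orbT.
Qed.

Lemma bar_diff_normalized G w : normalized G -> None \in w -> bar_diff l r G w = 0.
Proof.
move=> Gn; case: w => // -[j|] w; rewrite bar_diff_cons.
  rewrite in_cons => /orP[//|w1]; rewrite bar_tail_normalized // Gn // addr0.
  by rewrite -{1}(subrr 0) (actlB V_bimod) subrr.
by move=> _; rewrite bar_tail_unit // (actl1 V_bimod) subrr.
Qed.

(** Since J^2 = 0 all merges vanish; the right action of the last letter remains, with the sign
    (-1)^(size u + 1). *)
Lemma bar_tail_rcons G u b :
  bar_tail r G (rcons (map Some u) (Some b)) =
  if odd (size u) then r (Some b) (G (map Some u)) else - r (Some b) (G (map Some u)).
Proof.
elim: u G => [|a u IHu] G; first by rewrite /= subr0.
rewrite [rcons _ _]/= bar_tail_cons IHu.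
have -> : premul r (Some a) G (rcons (map Some u) (Some b)) = 0 by case: u {IHu}.
by rewrite oppr0 sub0r /=; case: odd; rewrite ?opprK.
Qed.

End Normalized.

Lemma letterP (w : seq letter) : None \in w \/ exists u, w = map Some u.
Proof.
elim: w => [|[j|] w IHw]; [by right; exists [::] | | by left; rewrite mem_head].
case: IHw => [w1|[u ->]]; first by left; rewrite inE w1 orbT.
by right; exists (j :: u).
Qed.

Notation i0 := (@Ordinal 3 0 isT).
Notation i1 := (@Ordinal 3 1 isT).
Notation i2 := (@Ordinal 3 2 isT).

Lemma ord3P (P : 'I_3 -> Prop) : P i0 -> P i1 -> P i2 -> forall i, P i.
Proof.
move=> P0 P1 P2 [[|[|[|//]]] lti]; [move: P0|move: P1|move: P2];
  by congr P; apply: val_inj.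
Qed.

Lemma sum_ord3 (V : nmodType) (F : 'I_3 -> V) : \sum_i F i = F i0 + F i1 + F i2.
Proof.
rewrite !big_ord_recl big_ord0 addr0 addrA.
by congr (F _ + F _ + F _); apply: val_inj.
Qed.

Lemma sum_letter (V : nmodType) (F : letter -> V) :
  \sum_a F a = F None + F (Some false) + F (Some true).
Proof.
rewrite (bigD1 None) //= (bigD1 (Some false)) //= (bigD1 (Some true)) //= big1 ?addr0 ?addrA //.
by case=> [[]|].
Qed.

(** * S_4(R) inside the 3 by 3 matrices: basis, actions, coordinates *)

Section Matrices.
Variable R : comNzRingType.
Local Notation M := 'M[R]_3.
Implicit Types (m : M) (j : bool).

Definition idx j : 'I_3 := if j then i2 else i1.

Definition mxl (a : letter) : M := if a is Some j then delta_mx i0 (idx j) else 1%:M.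

Definition lact a m := mxl a *m m.
Definition ract a m := m *m mxl a.

Lemma mxlM a b : mxl a *m mxl b = oapp mxl 0 (lmul a b).
Proof.
case: a b => [a|] [b|] /=; rewrite ?mulmx1 ?mul1mx //.
by rewrite mul_delta_mx_0 //; case: a.
Qed.

Lemma bimodule_mx : bimodule lact ract.
Proof.
split.
- by move=> a m1 m2; rewrite /lact mulmxBr.
- by move=> a m1 m2; rewrite /ract mulmxBl.
- by move=> m; apply: mul1mx.
- by move=> m; apply: mulmx1.
- move=> a b m; rewrite /lact mulmxA mxlM.
  by case: lmul => //=; rewrite mul0mx.
- move=> a b m; rewrite /ract -mulmxA mxlM.
  by case: lmul => //=; rewrite mulmx0.
- by move=> a b m; rewrite /lact /ract mulmxA.
Qed.

Lemma lactE j m i k : lact (Some j) m i k = if i == i0 then m (idx j) k else 0.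
Proof.
rewrite /lact mxE (bigD1 (idx j)) //= big1 => [|x xj]; last first.
  by rewrite mxE (negPf xj) andbF mul0r.
by rewrite mxE eqxx andbT addr0; case: eqP; rewrite ?mul1r ?mul0r.
Qed.

Lemma ractE j m i k : ract (Some j) m i k = if k == idx j then m i i0 else 0.
Proof.
rewrite /ract mxE (bigD1 i0) //= big1 => [|x xj]; last first.
  by rewrite mxE (negPf xj) mulr0.
by rewrite mxE eqxx /= addr0; case: eqP; rewrite ?mulr1 ?mulr0.
Qed.

Lemma inS4P m : inS4 m <->
  [/\ m i1 i0 = 0, m i2 i0 = 0, m i1 i2 = 0 & m i2 i1 = 0] /\
  (m i1 i1 = m i0 i0 /\ m i2 i2 = m i0 i0).
Proof.
split=> [[a [b [c ->]]]|]; first by rewrite !mxE.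
case=> [[m10 m20 m12 m21] [m11 m22]]; exists (m i0 i0), (m i0 i1), (m i0 i2).
by apply/matrixP => i k; rewrite mxE; elim/ord3P: i; elim/ord3P: k.
Qed.

Lemma inS4_0 : inS4 (0 : M).
Proof. by apply/inS4P; rewrite !mxE. Qed.

Lemma inS4B m1 m2 : inS4 m1 -> inS4 m2 -> inS4 (m1 - m2).
Proof.
move=> /inS4P[[a1 a2 a3 a4] [a5 a6]] /inS4P[[b1 b2 b3 b4] [b5 b6]].
by apply/inS4P; rewrite !mxE a1 a2 a3 a4 a5 a6 b1 b2 b3 b4 b5 b6 !subr0.
Qed.

Lemma inS4N m : inS4 m -> inS4 (- m).
Proof. by move=> Sm; rewrite -sub0r; apply/inS4B/Sm/inS4_0. Qed.

Lemma inS4D m1 m2 : inS4 m1 -> inS4 m2 -> inS4 (m1 + m2).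
Proof. by move=> S1 S2; rewrite -[m2]opprK; apply/inS4B/inS4N. Qed.

Lemma inS4Z c m : inS4 m -> inS4 (c *: m).
Proof.
move=> /inS4P[[a1 a2 a3 a4] [a5 a6]].
by apply/inS4P; rewrite !mxE a1 a2 a3 a4 a5 a6 !mulr0.
Qed.

Lemma inS4_sum (I : Type) (s : seq I) (F : I -> M) :
  (forall i, inS4 (F i)) -> inS4 (\sum_(i <- s) F i).
Proof.
move=> SF; apply: (big_ind (fun m => inS4 m)) => //; first exact: inS4_0.
exact: inS4D.
Qed.

Lemma inS4M m1 m2 : inS4 m1 -> inS4 m2 -> inS4 (m1 *m m2).
Proof.
move=> /inS4P[[a1 a2 a3 a4] [a5 a6]] /inS4P[[b1 b2 b3 b4] [b5 b6]].
apply/inS4P; rewrite !mxE !sum_ord3 a1 a2 a3 a4 a5 a6 b1 b2 b3 b4 b5 b6.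
by rewrite !(mulr0, mul0r, addr0, add0r).
Qed.

Lemma inS4_mxl a : inS4 (mxl a).
Proof. by apply/inS4P; case: a => [[]|]; rewrite !mxE. Qed.

(** The preimage in M of the submodule N_0 of M/A; both actions of J carry it into A. *)
Definition lower0 m := m i1 i0 = 0 /\ m i2 i0 = 0.

Lemma lower0_idx m : lower0 m <-> forall j, m (idx j) i0 = 0.
Proof.
by split=> [[m1 m2] []|mj] //; split; [apply: (mj false)|apply: (mj true)].
Qed.

Lemma inS4_lact_lower0 j m : lower0 m -> inS4 (lact (Some j) m).
Proof.
by move=> /lower0_idx mj; apply/inS4P; rewrite !lactE /= mj.
Qed.

Lemma inS4_ract_lower0 j m : lower0 m -> inS4 (ract (Some j) m).
Proof.
by move=> [m1 m2]; apply/inS4P; rewrite !ractE m1 m2 /= !if_same; case: j.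
Qed.

Definition coord (a : letter) m : R := if a is Some j then m i0 (idx j) else m i0 i0.

Lemma coord_mxl a b : coord a (mxl b) = (a == b)%:R.
Proof. by case: a b => [[]|] [[]|]; rewrite /coord /mxl !mxE. Qed.

Lemma coordD a c m1 m2 : coord a (c *: m1 + m2) = c * coord a m1 + coord a m2.
Proof. by case: a => [a|]; rewrite /= !mxE. Qed.

Lemma inS4_coord m : inS4 m -> m = \sum_a coord a m *: mxl a.
Proof.
move=> /inS4P[[a1 a2 a3 a4] [a5 a6]]; rewrite sum_letter.
apply/matrixP => i k; rewrite !mxE /=.
elim/ord3P: i; elim/ord3P: k; rewrite /= ?a1 ?a2 ?a3 ?a4 ?a5 ?a6;
  by rewrite !(mulr0, mulr1, addr0, add0r).
Qed.

Lemma coordM a b : inS4 a -> inS4 b ->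
  [/\ coord None (a *m b) = coord None a * coord None b &
  forall j, coord (Some j) (a *m b) =
    coord None a * coord (Some j) b + coord (Some j) a * coord None b].
Proof.
move=> /inS4P[[a1 a2 a3 a4] [a5 a6]] /inS4P[[b1 b2 b3 b4] [b5 b6]].
split; first by rewrite /= mxE sum_ord3 b1 b2 !mulr0 !addr0.
by case; rewrite /= mxE sum_ord3 ?b3 ?b4 ?b5 ?b6 mulr0 addr0.
Qed.

End Matrices.

(** * Multilinear cochains as functions on words *)

Section Extension.
Variable R : comNzRingType.
Local Notation M := 'M[R]_3.
Implicit Types (h : seq letter -> M) (f : seq M -> M) (s : seq M).

(* Multilinear extension of a function on words in the basis [mxl] of S_4(R). *)
Fixpoint ext h s : M :=
  if s is m :: s' then \sum_a coord a m *: ext (fun w => h (a :: w)) s' else h [::].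

Lemma ext_cons h m s :
  ext h (m :: s) = \sum_a coord a m *: ext (fun w => h (a :: w)) s.
Proof. by []. Qed.

Lemma eq_ext h1 h2 s :
  (forall w, size w = size s -> h1 w = h2 w) -> ext h1 s = ext h2 s.
Proof.
elim: s h1 h2 => [|m s IHs] h1 h2 eqh; first exact: eqh.
apply: eq_bigr => a _; congr (_ *: _); apply: IHs => w sz_w.
by apply: eqh; rewrite /= sz_w.
Qed.

Lemma extB h1 h2 s : ext (fun w => h1 w - h2 w) s = ext h1 s - ext h2 s.
Proof.
elim: s h1 h2 => [|m s IHs] h1 h2 //; rewrite !ext_cons -sumrB.
by apply: eq_bigr => a _; rewrite IHs scalerBr.
Qed.

Lemma ext0 s : ext (fun=> 0) s = 0.
Proof.
by elim: s => //= m s IHs; rewrite big1 // => a _; rewrite IHs scaler0.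
Qed.

Lemma extN h s : ext (fun w => - h w) s = - ext h s.
Proof.
by rewrite -[RHS]sub0r -(ext0 s) -extB; apply: eq_ext => w _; rewrite sub0r.
Qed.

Lemma extD h1 h2 s : ext (fun w => h1 w + h2 w) s = ext h1 s + ext h2 s.
Proof.
by rewrite -[ext h2 s]opprK -extN -extB; apply: eq_ext => w _; rewrite opprK.
Qed.

Lemma inS4_ext h s : (forall w, size w = size s -> inS4 (h w)) -> inS4 (ext h s).
Proof.
elim: s h => [|m s IHs] h hS; first exact: hS.
apply: inS4_sum => a; apply/inS4Z/IHs => w sz_w.
by apply: hS; rewrite /= sz_w.
Qed.

Lemma sum_coord_mxl (V : lmodType R) (F : letter -> V) b :
  \sum_a coord a (mxl R b) *: F a = F b.
Proof.
rewrite (bigD1 b) //= coord_mxl eqxx scale1r big1 ?addr0 // => a /negPf ab.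
by rewrite coord_mxl ab scale0r.
Qed.

Lemma ext_mxl h w : ext h (map (mxl R) w) = h w.
Proof. by elim: w h => //= a w IHw h; rewrite sum_coord_mxl IHw. Qed.

Lemma ext_is_cochain n h : is_cochain n (ext h).
Proof.
move=> s [sz_s sS] i; rewrite -sz_s => {n sz_s sS} lt_i r y _.
elim: s i h lt_i => [|m s IHs] [|i] h //= lt_i.
  rewrite scaler_sumr -big_split; apply: eq_bigr => a _ /=.
  by rewrite coordD scalerDl scalerA.
rewrite scaler_sumr -big_split; apply: eq_bigr => a _ /=.
by rewrite IHs // scalerDr !scalerA mulrC.
Qed.

Lemma cochain_arg_cons n m s : cochain_arg n.+1 (m :: s) <-> inS4 m /\ cochain_arg n s.
Proof.
split=> [[[sz_s] sS]|[mS [sz_s sS]]].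
  by split; [apply: (sS 0) | split=> // i; apply: (sS i.+1)].
by split=> [|[|i]] /=; [rewrite sz_s | | apply: sS].
Qed.

Lemma cochain_arg_mxl w : cochain_arg (size w) (map (mxl R) w).
Proof.
split=> [|i]; rewrite size_map // => lt_i; rewrite (nth_map None) //.
exact: inS4_mxl.
Qed.

Lemma cochain_ext n f s :
  is_cochain n f -> cochain_arg n s -> f s = ext (fun w => f (map (mxl R) w)) s.
Proof.
elim: s n f => [|m s IHs] [|n] f fC sC; try by case: sC.
have /cochain_arg_cons[mS sC'] := sC.
have fD r y y' : inS4 y -> inS4 y' -> f (r *: y + y' :: s) = r *: f (y :: s) + f (y' :: s).
  move=> yS y'S; have /= := fC (y :: s) _ 0 isT r y' y'S.
  by apply; apply/cochain_arg_cons.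
(* Additivity at zero comes from the linearity clause with [r = -1], applied to [m] twice. *)
have f0 : f (0 :: s) = 0.
  have := fD (-1) _ _ mS mS; rewrite !scaleN1r addNr => ->; exact: addNr.
rewrite {1}(inS4_coord mS) /=.
have -> (t : seq letter) : f (\sum_(a <- t) coord a m *: mxl R a :: s) =
    \sum_(a <- t) coord a m *: f (mxl R a :: s).
  elim: t => [|a t IHt]; first by rewrite !big_nil.
  rewrite !big_cons fD ?IHt //; first exact: inS4_mxl.
  by apply: inS4_sum => b; apply/inS4Z/inS4_mxl.
apply: eq_bigr => a _; congr (_ *: _).
apply: (IHs n (fun s => f (mxl R a :: s))) => // t tC i lt_i r y yS.
by apply: (fC (mxl R a :: t) _ i.+1) => //; apply/cochain_arg_cons; split=> //; apply: inS4_mxl.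
Qed.

(** With [mx_tail], the counterpart of [premul] and [bar_tail] for matrix arguments: a recursive
    form of [hdiff]. *)
Definition mx_premul (f : seq M -> M) m s : M :=
  if s is m' :: s' then f (m *m m' :: s') else f [::] *m m.

Fixpoint mx_tail f s : M :=
  if s is m :: s' then - mx_premul f m s' - mx_tail (fun t => f (m :: t)) s' else 0.

Lemma hdiff_cons n f m s : size s = n ->
  hdiff n f (m :: s) = m *m f s + mx_tail f (m :: s).
Proof.
move=> sz_s; rewrite /hdiff -addrA; congr (_ + _).
elim: s n f m sz_s => [|m' s IHs] n f m <- /=.
  by rewrite big_ord0 add0r expr1 scaleN1r subr0.
have /= <- := IHs _ (fun t => f (m :: t)) m' erefl.
rewrite big_ord_recl -addrA expr1 scaleN1r; congr (- f _ + _).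
  by rewrite /Defs.merge /= drop0.
rewrite opprD; congr (_ + _).
  rewrite -sumrN; apply: eq_bigr => i _.
  by rewrite [in LHS]exprS mulN1r scaleNr.
by rewrite exprS mulN1r scaleNr.
Qed.

Lemma mx_tail_lincomb (I : finType) (c : I -> R) (f : I -> seq M -> M) s :
  mx_tail (fun t => \sum_i c i *: f i t) s = \sum_i c i *: mx_tail (f i) s.
Proof.
elim: s f => [|m s IHs] f /=; first by rewrite big1 // => i _; rewrite scaler0.
rewrite (IHs (fun i t => f i (m :: t))).
under [RHS]eq_bigr => i _ do rewrite scalerBr scalerN.
rewrite sumrB sumrN; congr (- _ - _).
case: s {IHs} => [|m' s] //=; rewrite mulmx_suml.
by apply: eq_bigr => i _; rewrite scalemxAl.
Qed.

Lemma ext_premul h m n s : inS4 m -> cochain_arg n s ->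
  \sum_a coord a m *: ext (premul (@ract R) a h) s = mx_premul (ext h) m s.
Proof.
move=> mS; case: s => [_|m' s] /=.
  rewrite [in RHS](inS4_coord mS) mulmx_sumr.
  by apply: eq_bigr => a _; rewrite -scalemxAr.
case: n => [[]//|n] /cochain_arg_cons[m'S _].
have [c0 cS] := coordM mS m'S.
rewrite !sum_letter !cS c0 /= !ext0 !scaler0 !addr0.
rewrite !scalerDl !scalerDr !scalerA.
set x := ext _ s; set y := ext _ s; set z := ext _ s.
by rewrite !addrA; congr (_ + _); rewrite addrAC.
Qed.

Lemma mx_tail_ext h n s : cochain_arg n s -> mx_tail (ext h) s = ext (bar_tail (@ract R) h) s.
Proof.
elim: s n h => [|m s IHs] [|n] h //; first by case.
move=> /cochain_arg_cons[mS sC] /=.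
rewrite -(ext_premul h mS sC).
rewrite (mx_tail_lincomb (fun a => coord a m) (fun a => ext (fun w => h (a :: w)))).
rewrite -sumrN -sumrB; apply: eq_bigr => a _.
by rewrite extB extN (IHs _ _ sC) scalerBr scalerN.
Qed.

Lemma ext_mulmx m h s : ext (fun w => m *m h w) s = m *m ext h s.
Proof.
elim: s h => //= m' s IHs h; rewrite mulmx_sumr.
by apply: eq_bigr => a _; rewrite IHs scalemxAr.
Qed.

Lemma hdiff_ext n h s : cochain_arg n.+1 s ->
  hdiff n (ext h) s = ext (bar_diff (@lact R) (@ract R) h) s.
Proof.
case: s => [[]//|m s] sC; have /cochain_arg_cons[mS [sz_s _]] := sC.
rewrite hdiff_cons // (mx_tail_ext h sC) !ext_cons.
rewrite {1}(inS4_coord mS) mulmx_suml -big_split; apply: eq_bigr => a _ /=.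
by rewrite (extD (fun w => lact a (h w))) (ext_mulmx (mxl R a)) scalerDr scalemxAl.
Qed.

(** A is closed under multiplication, so [hdiff] evaluates its cochain only at tuples from A. *)
Lemma eq_hdiff n f1 f2 s : (forall t, cochain_arg n t -> f1 t = f2 t) ->
  cochain_arg n.+1 s -> hdiff n f1 s = hdiff n f2 s.
Proof.
move=> eqf [sz_s sS]; rewrite /hdiff.
have nthS i : (i <= n)%N -> inS4 (nth 0 s i) by rewrite -ltnS -sz_s => /sS.
congr (_ + _ + _); [congr (_ *m _) | | congr (_ *: (_ *m _))].
- apply: eqf; split=> [|i]; rewrite size_behead sz_s //= => lt_i.
  by rewrite nth_behead; apply: nthS.
- apply: eq_bigr => i _; congr (_ *: _); apply: eqf.
  have lt_in := ltn_ord i.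
  have sz_m : size (Defs.merge i s) = n.
    rewrite size_cat /= size_drop size_takel ?sz_s; last by apply: ltnW; apply: ltnW.
    by rewrite subSS addnS -addSn subnKC.
  split=> // k; rewrite sz_m => lt_k; rewrite nth_cat size_takel; last first.
    by rewrite sz_s; apply: ltnW; apply: ltnW.
  case: ltnP => [lt_ki|le_ik]; first by rewrite nth_take //; apply/nthS/ltnW.
  case def_k: (k - i)%N => [|d] /=; first by apply: inS4M; apply: nthS => //; apply: ltnW.
  rewrite nth_drop; apply: nthS.
  by rewrite 2!addSn -addnS -def_k subnKC.
apply: eqf; split=> [|k]; rewrite size_takel ?sz_s // => lt_k.
by rewrite nth_take //; apply/nthS/ltnW.
Qed.

Definition bar := bar_diff (@lact R) (@ract R).

Lemma hdiff_bar n f s : is_cochain n f -> cochain_arg n.+1 s ->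
  hdiff n f s = ext (bar (fun w => f (map (mxl R) w))) s.
Proof.
move=> fC sC; rewrite -(hdiff_ext _ sC).
by apply: eq_hdiff sC => t tC; apply: cochain_ext fC tC.
Qed.

Lemma cocycle_ext n h :
  (forall w, size w = n.+1 -> inS4 (bar h w)) -> is_cocycle n (ext h).
Proof.
move=> hZ; split=> [|s sC]; first exact: ext_is_cochain.
rewrite subr0 (hdiff_ext h sC); apply: inS4_ext => w.
by case: sC => -> _; apply: hZ.
Qed.

Lemma cocycle_bar n f : is_cocycle n f ->
  forall w, size w = n.+1 -> inS4 (bar (fun u => f (map (mxl R) u)) w).
Proof.
move=> [fC fZ] w sz_w; have wC : cochain_arg n.+1 (map (mxl R) w).
  by rewrite -sz_w; apply: cochain_arg_mxl.
by have := fZ _ wC; rewrite subr0 (hdiff_bar fC wC) ext_mxl.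
Qed.

(** Degree 0 fits the same form as the others because [bar h] vanishes at the empty word. *)
Lemma cohomologous_ext n f g h : is_cochain n f -> is_cochain n g ->
  (forall w, size w = n -> inS4 (f (map (mxl R) w) - (g (map (mxl R) w) + bar h w))) ->
  cohomologous n f g.
Proof.
case: n => [|n] fC gC fgh.
  move=> s [/size0nil-> _]; have := fgh [::] erefl.
  by rewrite addr0.
exists (ext h); split=> [|s sC]; first exact: ext_is_cochain.
rewrite (hdiff_ext h sC) (cochain_ext fC sC) (cochain_ext gC sC) -extD -extB.
by apply: inS4_ext => w; case: sC => -> _; apply: fgh.
Qed.

Lemma cohomologous_bar n f g : cohomologous n f g -> exists h, forall w, size w = n ->
  inS4 (f (map (mxl R) w) - (g (map (mxl R) w) + bar h w)).
Proof.
case: n => [|n] fg.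
  exists (fun=> 0) => w /size0nil->; rewrite addr0; apply: fg; split=> //.
case: fg => h [hC fgh]; exists (fun w => h (map (mxl R) w)) => w sz_w.
have wC : cochain_arg n.+1 (map (mxl R) w) by rewrite -sz_w; apply: cochain_arg_mxl.
by have := fgh _ wC; rewrite (hdiff_bar hC wC) ext_mxl.
Qed.

Lemma lincomb_is_cochain n k (c : 'I_k -> R) (z : 'I_k -> seq M -> M) :
  (forall i, is_cochain n (z i)) -> is_cochain n (lincomb c z).
Proof.
move=> zC s sC i lt_i r y yS; rewrite /lincomb scaler_sumr -big_split.
by apply: eq_bigr => j _; rewrite /= zC // scalerDr !scalerA mulrC.
Qed.

(** Restriction to basis words and [ext] are mutually inverse on multilinear cochains and respect
    the differentials, so freeness can be tested on words. *)
Lemma HH_free_of_words n (I : finType) (z : I -> seq letter -> M) :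
  (forall i w, size w = n.+1 -> inS4 (bar (z i) w)) ->
  (forall F, (forall w, size w = n.+1 -> inS4 (bar F w)) ->
    exists (c : I -> R) h, forall w, size w = n ->
      inS4 (F w - (\sum_i c i *: z i w + bar h w))) ->
  (forall (c : I -> R) h,
    (forall w, size w = n -> inS4 (\sum_i c i *: z i w - bar h w)) ->
    forall i, c i = 0) ->
  HH_free_of_rank R n #|I|.
Proof.
move=> zZ z_gen z_free; exists (fun i => ext (z (enum_val i))).
have lincombE (c : 'I_#|I| -> R) w :
    lincomb c (fun i => ext (z (enum_val i))) (map (mxl R) w) =
    \sum_(i : I) c (enum_rank i) *: z i w.
  rewrite /lincomb [RHS](reindex_onto (@enum_val I I) enum_rank) => [|i _]; last exact: enum_rankK.
  by apply: eq_big => [i|i _]; rewrite enum_valK ?eqxx // ext_mxl.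
have lincombC c : is_cochain n (lincomb c (fun i => ext (z (enum_val i)))).
  by apply: lincomb_is_cochain => i; apply: ext_is_cochain.
split; first by move=> i; apply/cocycle_ext/zZ.
split=> [f fZ|c].
  have [c [h cP]] := z_gen _ (cocycle_bar fZ).
  exists (fun i => c (enum_val i)); apply: (cohomologous_ext (h := h)) => //.
    by case: fZ.
  move=> w /cP; rewrite lincombE.
  by under [X in _ -> inS4 (_ - (X + _))]eq_bigr => i _ do rewrite enum_rankK.
move=> /cohomologous_bar[h hP] i; rewrite -[i]enum_valK.
apply: (z_free (fun i => c (enum_rank i)) h) => w sz_w.
by have := hP w sz_w; rewrite lincombE add0r.
Qed.

End Extension.

(** * Cocycles and coboundaries on words in the letters of J *)

Section Words.
Variable R : comNzRingType.
Local Notation M := 'M[R]_3.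
Local Notation jword := (map (@Some bool)).
Implicit Types (F G h : seq letter -> M) (u v : seq bool).

(** Left multiplication by J reaches only the first row. Elsewhere the right action of the last
    letter remains, moving the first column to the column [idx b]. *)
Lemma bar_rconsE h u b i k : i != i0 ->
  bar h (jword (rcons u b)) i k =
    let x := if k == idx b then h (jword u) i i0 else 0 in
    if odd (size u) then x else - x.
Proof.
move=> /negPf i_neq0; rewrite /bar map_rcons.
have -> : bar_diff (@lact R) (@ract R) h (rcons (jword u) (Some b)) i k =
    bar_tail (@ract R) h (rcons (jword u) (Some b)) i k.
  by case: u => [|j u]; rewrite /= mxE lactE i_neq0 add0r.
by rewrite bar_tail_rcons; case: odd; [|rewrite [LHS]mxE]; rewrite ractE.
Qed.

(** Appending E_13 exhibits the entry (i1,i0) at (i1,i2), and appending E_12 exhibits (i2,i0) at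
    (i2,i1); elements of A vanish at both places. *)
Lemma cocycle_lower0 F u :
  (forall b, inS4 (bar F (jword (rcons u b)))) -> lower0 (F (jword u)).
Proof.
move=> FZ; split.
- have /inS4P[[_ _ + _] _] := FZ true; rewrite bar_rconsE //=.
  by case: odd => // /eqP; rewrite oppr_eq0 => /eqP.
- have /inS4P[[_ _ _ +] _] := FZ false; rewrite bar_rconsE //=.
  by case: odd => // /eqP; rewrite oppr_eq0 => /eqP.
Qed.

Lemma inS4_bar_lower0 h n v :
  (forall u, size u = n -> lower0 (h (jword u))) -> size v = n.+1 ->
  inS4 (bar h (jword v)).
Proof.
move=> h0 sz_v; have tailS : inS4 (bar_tail (@ract R) h (jword v)).
  case/lastP: v sz_v => // u b; rewrite size_rcons map_rcons bar_tail_rcons => -[sz_u].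
  have Su := inS4_ract_lower0 b (h0 u sz_u).
  by case: odd => //; apply: inS4N.
case: v sz_v tailS => // j v [sz_v] tailS; apply: inS4D tailS.
exact/inS4_lact_lower0/h0.
Qed.

(** A normalized cochain is a cocycle when its values on the words in J lie in [lower0], and
    cocycles have such values there. It remains to choose, at each of the 2^n words, [k] matrices
    that represent a basis modulo coboundaries. *)
Lemma HH_free_of_tops n k (e : seq bool -> 'I_k -> M) :
  (forall u i, lower0 (e u i)) ->
  (forall F, (forall u, size u = n -> lower0 (F (jword u))) ->
    exists (c : seq bool -> 'I_k -> R) h, normalized h /\ forall u, size u = n ->
      inS4 (F (jword u) - (\sum_i c u i *: e u i + bar h (jword u)))) ->
  (forall (c : seq bool -> 'I_k -> R) h,
    (forall u, size u = n -> inS4 (\sum_i c u i *: e u i - bar h (jword u))) ->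
    forall u i, size u = n -> c u i = 0) ->
  HH_free_of_rank R n (k * 2 ^ n).
Proof.
move=> e0 e_gen e_free.
have -> : (k * 2 ^ n)%N = #|{: n.-tuple bool * 'I_k}|.
  by rewrite card_prod card_tuple card_bool card_ord mulnC.
pose z (p : n.-tuple bool * 'I_k) (w : seq letter) : M :=
  if w == jword p.1 then e p.1 p.2 else 0.
have z_norm p : normalized (z p).
  by move=> w w1; rewrite /z; case: eqP w1 => // -> /mapP[].
have z0 p w : lower0 (z p w).
  by rewrite /z; case: eqP => // _; split; rewrite mxE.
have sum_z (c : n.-tuple bool * 'I_k -> R) (u : n.-tuple bool) :
    \sum_p c p *: z p (jword u) = \sum_i c (u, i) *: e u i.
  have -> : \sum_p c p *: z p (jword u) = \sum_v \sum_i c (v, i) *: z (v, i) (jword u).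
    by rewrite pair_bigA; apply: eq_bigr => -[v i].
  rewrite (bigD1 u) //= [X in _ + X]big1 ?addr0 => [|v vu].
    by apply: eq_bigr => i _; rewrite /z eqxx.
  apply: big1 => i _; rewrite /z /= (inj_eq (inj_map (@Some_inj _))).
  by rewrite (inj_eq val_inj) eq_sym (negPf vu) scaler0.
have sum_z1 (c : n.-tuple bool * 'I_k -> R) w : None \in w -> \sum_p c p *: z p w = 0.
  by move=> w1; apply: big1 => p _; rewrite z_norm // scaler0.
have Rbi := bimodule_mx R.
apply: (HH_free_of_words (z := z)).
- move=> p w sz_w; case: (letterP w) => [w1|[u def_w]].
    by rewrite /bar bar_diff_normalized //; apply: inS4_0.
  by rewrite def_w; apply: (@inS4_bar_lower0 _ n) => [v _|]; rewrite ?z0 // -sz_w def_w size_map.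
- move=> F FZ.
  have [|||//|h1 h1P] := @cocycle_normalize n _ _ _ (@inS4 R) F Rbi.
  + exact: inS4_0.
  + exact: inS4B.
  + by move=> a m; apply/inS4M/inS4_mxl.
  have [|c [h2 [h2_norm h2P]]] := e_gen (fun w => F w - bar h1 w).
    move=> u sz_u; apply: (cocycle_lower0 (F := fun w => F w - bar h1 w)) => b.
    rewrite /bar (bar_diffB Rbi) (bar_diffK Rbi) subr0.
    by apply: FZ; rewrite size_map size_rcons sz_u.
  (* [h1] normalizes [F], and [h2] reduces the normalized cocycle to the chosen matrices. *)
  exists (fun p : n.-tuple bool * 'I_k => c p.1 p.2), (fun w => h1 w + h2 w) => w sz_w.
  rewrite /bar (bar_diffD Rbi) -/(bar _ _) addrCA opprD addrA.
  case: (letterP w) => [w1|[u def_w]].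
    by rewrite sum_z1 // bar_diff_normalized // addr0 subr0; apply: h1P.
  have sz_u : size u == n by rewrite -sz_w def_w size_map.
  by have := h2P u (eqP sz_u); rewrite def_w -[u]/(tval (Tuple sz_u)) sum_z.
- move=> c h cP [u i].
  (* Extends the coefficients by zero to words of other lengths, as [e_free] takes families indexed
     by all words. *)
  pose c' (v : seq bool) i := if insub v is Some t then c (t, i) else 0.
  have c'E (t : n.-tuple bool) j : c' t j = c (t, j) by rewrite /c' valK.
  rewrite -c'E; apply: (e_free c' h _ u i (size_tuple u)) => v sz_v.
  have sz_v' : size v == n by apply/eqP.
  have := cP (jword v); rewrite size_map sz_v => /(_ erefl).
  rewrite -[v]/(tval (Tuple sz_v')) sum_z.
  by under [in X in _ -> X]eq_bigr => j _ do rewrite c'E.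
Qed.

(** * Bases in degree zero and in positive degrees *)

Lemma sum_ord4 (V : nmodType) (c : 'I_4 -> V) :
  \sum_i c i = c (@Ordinal 4 0 isT) + c (@Ordinal 4 1 isT) +
    c (@Ordinal 4 2 isT) + c (@Ordinal 4 3 isT).
Proof.
rewrite !big_ord_recl big_ord0 addr0 !addrA.
by congr (c _ + c _ + c _ + c _); apply: val_inj.
Qed.

Lemma HH0_free : HH_free_of_rank R 0 4.
Proof.
(* A basis of N_0: modulo A, the entries (i0,i1) and (i0,i2) disappear, and multiples of the
   identity clear the entry (i2,i2). *)
pose e (u : seq bool) (i : 'I_4) : M :=
  [:: delta_mx i0 i0; delta_mx i1 i1; delta_mx i1 i2; delta_mx i2 i1]`_i.
rewrite -[4%N]/(4 * 2 ^ 0)%N; apply: (HH_free_of_tops (e := e)).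
- by move=> u [[|[|[|[|//]]]] lti]; split; rewrite /e /= !mxE.
- move=> F F0; set m := F (jword [::]); have [m1 m2] : lower0 m by apply: F0.
  exists (fun _ i => [:: m i0 i0 - m i2 i2; m i1 i1 - m i2 i2; m i1 i2; m i2 i1]`_i), (fun=> 0).
  split=> // u /size0nil->; rewrite -/m [bar _ _](_ : _ = 0) // addr0 sum_ord4.
  apply/inS4P; rewrite !mxE /= m1 m2 !(mulr0, mulr1, addr0, add0r, subr0) !subrr.
  by rewrite oppr0 !subKr.
- move=> c h cP u i /size0nil->; have := cP [::] erefl.
  rewrite [bar _ _](_ : _ = 0) // subr0 sum_ord4 => /inS4P; rewrite !mxE /=.
  rewrite !(mulr0, mulr1, addr0, add0r) => -[[_ _ c2 c3] [c1 c0]].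
  case: i => [[|[|[|[|//]]]] lti].
  + by rewrite [RHS]c0; congr (c _); apply: val_inj.
  + by rewrite [RHS]c0 -c1; congr (c _); apply: val_inj.
  + by rewrite -[RHS]c2; congr (c _); apply: val_inj.
  + by rewrite -[RHS]c3; congr (c _); apply: val_inj.
Qed.

(* Coboundaries fill the entry (i1,i2) at the words that end with E_13 and the entry
   (i2,i1) at those that end with E_12; the other of the two entries survives. *)
Definition top (u : seq bool) (i : 'I_3) : M :=
  [:: delta_mx i0 i0; delta_mx i1 i1;
      if last false u then delta_mx i2 i1 else delta_mx i1 i2]`_i.

Lemma HHS_free n : HH_free_of_rank R n.+1 (3 * 2 ^ n.+1).
Proof.
apply: (HH_free_of_tops (e := top)).
- move=> u i; elim/ord3P: i; split; rewrite /top /=; try case: last;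
    by rewrite !mxE.
- move=> F F0.
  (* The first column of [h] is chosen so that appending E_12 reproduces the entry (i2,i1) of [F]
     and appending E_13 its entry (i1,i2); the sign offsets that of [bar_rconsE]. *)
  pose h (w : seq letter) : M := if None \in w then 0 else
    (if odd (size w) then 1 else -1) *:
    (F (rcons w (Some false)) i2 i1 *: delta_mx i2 i0 +
     F (rcons w (Some true)) i1 i2 *: delta_mx i1 i0).
  have hE u b i k : i != i0 -> bar h (jword (rcons u b)) i k =
      if k == idx b then
        if i == i2 then F (jword (rcons u false)) i2 i1 else F (jword (rcons u true)) i1 i2
      else 0.
    move=> i_neq0; rewrite bar_rconsE //=; case: (k == idx b); last first.
      by case: odd; rewrite ?oppr0.
    have -> : h (jword u) i i0 = (if odd (size u) then 1 else -1) *
        if i == i2 then F (jword (rcons u false)) i2 i1 else F (jword (rcons u true)) i1 i2.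
      rewrite /h ifF; last by apply/negP=> /mapP[].
      rewrite size_map !map_rcons !mxE.
      by elim/ord3P: i i_neq0 => //= _; rewrite !(mulr0, mulr1, addr0, add0r).
    by case: odd; rewrite ?mulN1r ?opprK ?mul1r.
  (* [bar h] also changes a diagonal entry, so the coefficients are read off from [G] and not from
     [F]. *)
  pose G u : M := F (jword u) - bar h (jword u).
  exists (fun u i => [:: G u i0 i0 - G u i2 i2; G u i1 i1 - G u i2 i2;
    if last false u then G u i2 i1 else G u i1 i2]`_i), h.
  split=> [w w1|v]; first by rewrite /h w1.
  case/lastP: v => // u b sz_v; have [v1 v2] := F0 _ sz_v.
  rewrite opprD addrA addrAC -/(G _); set v := rcons u b.
  have G1 : G v i1 i0 = 0 by rewrite /G 2!mxE hE //= v1 (_ : (_ == _) = false) ?subrr //; case: (b).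
  have G2 : G v i2 i0 = 0 by rewrite /G 2!mxE hE //= v2 (_ : (_ == _) = false) ?subrr //; case: (b).
  have G3 : if b then G v i1 i2 = 0 else G v i2 i1 = 0.
    by rewrite /G /v; case: (b); rewrite 2!mxE hE //= subrr.
  move: (G v) G1 G2 G3 => m m1 m2 m3; rewrite sum_ord3 /top last_rcons.
  apply/inS4P; rewrite !mxE /= m1 m2.
  by case: b m3 {sz_v v1 v2 v} => m3; rewrite !mxE /= ?m3
    !(mulr0, mulr1, addr0, add0r, subr0, oppr0, subrr, subKr).
- move=> c h cP.
  (* At each word [top] leaves empty the very entry that [bar h] fills from the first column of [h],
     so that column vanishes below the diagonal and [bar h] lies in A. *)
  have h0 u : size u = n -> lower0 (h (jword u)).
    move=> sz_u; have sz_ub b : size (rcons u b) = n.+1 by rewrite size_rcons sz_u.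
    split.
      have /inS4P[[_ _ + _] _] := cP _ (sz_ub true).
      rewrite !mxE bar_rconsE // sum_ord3 /top last_rcons !mxE /=.
      rewrite !(mulr0, addr0, add0r).
      by case: odd; rewrite ?opprK // => /eqP; rewrite oppr_eq0 => /eqP.
    have /inS4P[[_ _ _ +] _] := cP _ (sz_ub false).
    rewrite !mxE bar_rconsE // sum_ord3 /top last_rcons !mxE /=.
    rewrite !(mulr0, addr0, add0r).
    by case: odd; rewrite ?opprK // => /eqP; rewrite oppr_eq0 => /eqP.
  move=> u i sz_u; have := inS4D (cP u sz_u) (inS4_bar_lower0 h0 sz_u).
  rewrite subrK sum_ord3 /top; case: last => /inS4P; rewrite !mxE /=;
    rewrite !(mulr0, mulr1, addr0, add0r) => -[[_ _ c12 c21] [c1 c0]];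
    by elim/ord3P: i; rewrite ?c1 -?c0.
Qed.

End Words.

Theorem theorem5p6 (R : comNzRingType) :
  HH_free_of_rank R 0 4 /\
  (forall n : nat, (1 <= n)%N -> HH_free_of_rank R n (3 * 2 ^ n)).
Proof. by split=> [|[//|n] _]; [apply: HH0_free | apply: HHS_free]. Qed.
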